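(* Let $G$ be a finitely generated nilpotent group of class $2$ given by a finite full rank presentation $G=\langle a_1,\dots,a_n\mid r_1,\dots,r_m\rangle_{\mathcal N_2}$, where $m\le n-2$. Then $Z(G)=G'$.
   Context: $Z(G)$ is the center and $G'=[G,G]$ the derived subgroup of $G$. $\mathcal N_2$ is the variety of all nilpotent groups of class at most $2$. For $A=\{a_1,\dots,a_n\}$ and a finite set $R=\{r_1,\dots,r_m\}$ of words in $A^{\pm1}$, $\langle A\mid R\rangle_{\mathcal N_2}=N_2(A)/\langle\langle R\rangle\rangle$, where $N_2(A)=F(A)/\gamma_3(F(A))$ is the free group in $\mathcal N_2$ with basis $A$ and $\langle\langle R\rangle\rangle$ is the normal closure of $R$. The relation matrix $M(A,R)$ is the $m\times n$ integer matrix whose $(i,j)$ entry is the sum of the exponents of all occurrences of $a_j$ in $r_i$; the presentation has full rank if $\operatorname{rank}M(A,R)=\min\{m,n\}$. *)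

(* Defs.v *)
From HB Require Import structures.
From mathcomp Require Import all_boot all_algebra.
From mathcomp Require Import boolp classical_sets.

Set Implicit Arguments.
Unset Strict Implicit.
Unset Printing Implicit Defensive.

Local Open Scope classical_set_scope.
Local Open Scope group_scope.
Local Open Scope quotient_scope.

Section Subgroups.
Variable G : groupType.

Definition is_subgroup (H : set G) : Prop :=
  H 1 /\ forall x y, H x -> H y -> H (x / y).

Definition is_normal (N : set G) : Prop :=
  is_subgroup N /\ forall x y, N x -> N (x ^ y).

Definition generated (S : set G) : set G := smallest is_subgroup S.

Definition normal_closure (S : set G) : set G := smallest is_normal S.

Definition commutator_subgroup (H K : set G) : set G :=
  generated [set [~ x, y] | x in H & y in K].

(* The lower central series is shifted by one: [lcs i] is gamma_(i+1). *)
Fixpoint lcs (i : nat) : set G :=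
  if i is j.+1 then commutator_subgroup (lcs j) setT else setT.

Definition gamma (k : nat) : set G := lcs k.-1.

Definition derived : set G := commutator_subgroup setT setT.

Definition center : set G := [set z | forall x, commute z x].

Definition finitely_generated : Prop :=
  exists s : seq G, generated [set x | x \in s] = setT.

Definition nilpotent_class_le (c : nat) : Prop := gamma c.+1 = [set 1].

Lemma subgroupV (H : set G) x : is_subgroup H -> H x -> H x^-1.
Proof. by case=> H1 HF Hx; rewrite -div1g; apply: HF. Qed.

Lemma subgroupM (H : set G) x y : is_subgroup H -> H x -> H y -> H (x * y).
Proof.
by move=> sH Hx /(subgroupV sH) Hy; rewrite -[y]invgK; apply: (proj2 sH).
Qed.

Lemma generated_is_subgroup (S : set G) : is_subgroup (generated S).
Proof.
split=> [A [[A1 _] _] //|x y Sx Sy A [sA SA]].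
by apply: (proj2 sA); [apply: Sx | apply: Sy].
Qed.

Lemma normal_closure_is_normal (S : set G) : is_normal (normal_closure S).
Proof.
split; last by move=> x y Sx A [nA SA]; apply: (proj2 nA); apply: Sx.
split=> [A [[[A1 _] _] _] //|x y Sx Sy A [nA SA]].
by apply: (proj2 (proj1 nA)); [apply: Sx | apply: Sy].
Qed.

Lemma generated_is_normal (S : set G) :
  (forall x y, S x -> S (x ^ y)) -> is_normal (generated S).
Proof.
move=> SJ; split=> [|x y Sx]; first exact: generated_is_subgroup.
have sS := generated_is_subgroup S.
apply: (Sx [set u | generated S (u ^ y)]); split; last first.
  by move=> u Su /=; apply: sub_gen_smallest; apply: SJ.
split=> [|u v Su Sv] /=; first by rewrite conj1g; case: sS.
by rewrite conjMg conjVg; apply: (proj2 sS).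
Qed.

Lemma lcs_is_normal i : is_normal (lcs i).
Proof.
elim: i => [|i [_ IHi]] /=; first by [].
apply: generated_is_normal => _ z [x Hx [y _ <-]].
by exists (x ^ z); [apply: IHi | exists (y ^ z); rewrite ?conjRg].
Qed.

End Subgroups.

Arguments center : clear implicits.
Arguments derived : clear implicits.
Arguments gamma : clear implicits.
Arguments finitely_generated : clear implicits.

Definition isomorphic (G H : groupType) : Prop :=
  exists f : {multiplicative G -> H}, bijective f.

Record normalSubgroup (G : groupType) := NormalSubgroup {
  normal_set : set G;
  normal_setP : is_normal normal_set
}.

Section QuotientGroup.
Variables (G : groupType) (N : normalSubgroup G).

Definition coset_rel : rel G := fun x y => `[< normal_set N (x^-1 * y) >].

Lemma coset_rel_refl : reflexive coset_rel.
Proof. by move=> x; apply/asboolP; rewrite mulVg; case: N => ? [[]]. Qed.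

Lemma coset_rel_sym : symmetric coset_rel.
Proof.
have sym x y : coset_rel x y -> coset_rel y x.
  move=> /asboolP Nxy; apply/asboolP; rewrite -[y^-1 * x]invgK invgM invgK.
  by apply: subgroupV Nxy; case: (normal_setP N).
by move=> x y; apply/idP/idP; apply: sym.
Qed.

Lemma coset_rel_trans : transitive coset_rel.
Proof.
move=> y x z /asboolP Nxy /asboolP Nyz; apply/asboolP.
rewrite -[z](mulVKg y) mulgA.
by apply: subgroupM; case: (normal_setP N).
Qed.

Canonical coset_equiv :=
  EquivRel coset_rel coset_rel_refl coset_rel_sym coset_rel_trans.

Definition quotientGroup : Type := {eq_quot coset_equiv}.

HB.instance Definition _ := Choice.on quotientGroup.
HB.instance Definition _ := EqQuotient.on quotientGroup.

Definition toquot (x : G) : quotientGroup := \pi_quotientGroup x.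

Definition quot_one : quotientGroup := toquot 1.
Definition quot_mul (a b : quotientGroup) : quotientGroup :=
  toquot (repr a * repr b).
Definition quot_inv (a : quotientGroup) : quotientGroup := toquot (repr a)^-1.

Lemma toquotP x y : reflect (toquot x = toquot y) (coset_rel x y).
Proof. by apply: (iffP idP) => [?|/eqmodP //]; apply/eqmodP. Qed.

Lemma toquot_repr a : toquot (repr a) = a.
Proof. exact: reprK. Qed.

Lemma quot_mulE x y : quot_mul (toquot x) (toquot y) = toquot (x * y).
Proof.
have [sN NJ] := normal_setP N.
have /toquotP/asboolP Nx := toquot_repr (toquot x).
have /toquotP/asboolP Ny := toquot_repr (toquot y).
apply/toquotP/asboolP; set u := repr _ in Nx *; set v := repr _ in Ny *.
have -> : (u * v)^-1 * (x * y) = (u^-1 * x) ^ v * (v^-1 * y).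
  by rewrite /conjg invgM !mulgA mulgK.
by apply: subgroupM; first exact: sN; [apply: NJ|].
Qed.

Lemma quot_invE x : quot_inv (toquot x) = toquot x^-1.
Proof.
have [sN NJ] := normal_setP N.
have /toquotP/asboolP Nx := toquot_repr (toquot x).
apply/toquotP/asboolP; set u := repr _ in Nx *; rewrite invgK.
have -> : u * x^-1 = ((u^-1 * x)^-1) ^ u^-1.
  by rewrite /conjg invgM !invgK !mulgA mulgK.
by apply: NJ; apply: subgroupV.
Qed.

Lemma quot_mulA : associative quot_mul.
Proof.
move=> a b c; rewrite -[a]toquot_repr -[b]toquot_repr -[c]toquot_repr.
by rewrite !quot_mulE mulgA.
Qed.

Lemma quot_mul1 : left_id quot_one quot_mul.
Proof. by move=> a; rewrite -[a]toquot_repr quot_mulE mul1g. Qed.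

Lemma quot_mulr1 : right_id quot_one quot_mul.
Proof. by move=> a; rewrite -[a]toquot_repr quot_mulE mulg1. Qed.

Lemma quot_mulV : left_inverse quot_one quot_inv quot_mul.
Proof. by move=> a; rewrite -[a]toquot_repr quot_invE quot_mulE mulVg. Qed.

Lemma quot_mulrV : right_inverse quot_one quot_inv quot_mul.
Proof. by move=> a; rewrite -[a]toquot_repr quot_invE quot_mulE mulgV. Qed.

HB.instance Definition _ := isGroup.Build quotientGroup
  quot_mulA quot_mul1 quot_mulr1 quot_mulV quot_mulrV.

Lemma toquotM : {morph toquot : x y / x * y}.
Proof. by move=> x y; rewrite -quot_mulE. Qed.

HB.instance Definition _ := isMultiplicative.Build _ _ toquot toquotM.

End QuotientGroup.

(* The letter [(a, false)] stands for a, and [(a, true)] for its inverse. *)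
Definition word (A : Type) := seq (A * bool).

Section FreeGroup.
Variable A : choiceType.

Definition letter_inv (x : A * bool) : A * bool := (x.1, ~~ x.2).

Definition word_inv (w : word A) : word A := rev (map letter_inv w).

Inductive free_eq : word A -> word A -> Prop :=
| free_eq_cancel u x v : free_eq (u ++ x :: letter_inv x :: v) (u ++ v)
| free_eq_refl w : free_eq w w
| free_eq_sym v w : free_eq v w -> free_eq w v
| free_eq_trans u v w : free_eq u v -> free_eq v w -> free_eq u w.

Definition free_rel : rel (word A) := fun v w => `[< free_eq v w >].

Lemma free_rel_refl : reflexive free_rel.
Proof. by move=> w; apply/asboolP; apply: free_eq_refl. Qed.

Lemma free_rel_sym : symmetric free_rel.
Proof.
by move=> v w; apply/asboolP/asboolP; apply: free_eq_sym.
Qed.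

Lemma free_rel_trans : transitive free_rel.
Proof.
move=> v u w /asboolP uv /asboolP vw; apply/asboolP.
exact: free_eq_trans uv vw.
Qed.

Canonical free_equiv :=
  EquivRel free_rel free_rel_refl free_rel_sym free_rel_trans.

Definition freeGroup : Type := {eq_quot free_equiv}.

HB.instance Definition _ := Choice.on freeGroup.
HB.instance Definition _ := EqQuotient.on freeGroup.

Definition free_of_word (w : word A) : freeGroup := \pi_freeGroup w.

Definition free_one : freeGroup := free_of_word [::].
Definition free_mul (a b : freeGroup) : freeGroup :=
  free_of_word (repr a ++ repr b).
Definition free_inv (a : freeGroup) : freeGroup :=
  free_of_word (word_inv (repr a)).

Lemma free_of_wordP v w : free_of_word v = free_of_word w <-> free_eq v w.
Proof. by split=> [/eqmodP/asboolP //|vw]; apply/eqmodP/asboolP. Qed.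

Lemma free_of_word_repr a : free_of_word (repr a) = a.
Proof. exact: reprK. Qed.

Lemma free_eq_ctx s t v w : free_eq v w -> free_eq (s ++ v ++ t) (s ++ w ++ t).
Proof.
elim=> {v w} [u x v|w|v w _ IH|u v w _ IH1 _ IH2].
- have := free_eq_cancel (s ++ u) x (v ++ t).
  by rewrite -!catA.
- exact: free_eq_refl.
- exact: free_eq_sym.
- exact: free_eq_trans IH1 IH2.
Qed.

Lemma free_eq_cat v v' w w' :
  free_eq v v' -> free_eq w w' -> free_eq (v ++ w) (v' ++ w').
Proof.
move=> /(free_eq_ctx [::] w) vv' /(free_eq_ctx v' [::]).
by rewrite !cats0; apply: free_eq_trans.
Qed.

Lemma letter_invK : involutive letter_inv.
Proof. by case=> a b; rewrite /letter_inv /= negbK. Qed.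

Lemma word_inv_cat v w : word_inv (v ++ w) = word_inv w ++ word_inv v.
Proof. by rewrite /word_inv map_cat rev_cat. Qed.

Lemma word_invK : involutive word_inv.
Proof. by move=> w; rewrite /word_inv map_rev revK mapK //; apply: letter_invK. Qed.

Lemma free_eq_inv v w : free_eq v w -> free_eq (word_inv v) (word_inv w).
Proof.
elim=> {v w} [u x v|w|v w _ IH|u v w _ IH1 _ IH2].
- rewrite !word_inv_cat /word_inv /= !rev_cons letter_invK -/(word_inv _).
  rewrite -!cats1 -!catA /=.
  have := free_eq_cancel (word_inv v) x (word_inv u).
  exact.
- exact: free_eq_refl.
- exact: free_eq_sym.
- exact: free_eq_trans IH1 IH2.
Qed.

Lemma free_eq_mulV w : free_eq (w ++ word_inv w) [::].
Proof.
elim: w => [|x w IHw] /=; first exact: free_eq_refl.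
rewrite /word_inv /= rev_cons -/(word_inv w) -cats1.
have := free_eq_ctx [:: x] [:: letter_inv x] IHw.
rewrite -!catA /= => /free_eq_trans; apply.
exact: (free_eq_cancel [::] x [::]).
Qed.

Lemma free_mulE v w :
  free_mul (free_of_word v) (free_of_word w) = free_of_word (v ++ w).
Proof.
by apply/free_of_wordP/free_eq_cat; apply/free_of_wordP/free_of_word_repr.
Qed.

Lemma free_invE w : free_inv (free_of_word w) = free_of_word (word_inv w).
Proof. by apply/free_of_wordP/free_eq_inv/free_of_wordP/free_of_word_repr. Qed.

Lemma free_mulA : associative free_mul.
Proof.
move=> a b c.
rewrite -[a]free_of_word_repr -[b]free_of_word_repr -[c]free_of_word_repr.
by rewrite !free_mulE catA.
Qed.

Lemma free_mul1 : left_id free_one free_mul.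
Proof. by move=> a; rewrite -[a]free_of_word_repr free_mulE. Qed.

Lemma free_mulr1 : right_id free_one free_mul.
Proof. by move=> a; rewrite -[a]free_of_word_repr free_mulE cats0. Qed.

Lemma free_mulrV : right_inverse free_one free_inv free_mul.
Proof.
move=> a; rewrite -[a]free_of_word_repr free_invE free_mulE.
exact/free_of_wordP/free_eq_mulV.
Qed.

Lemma free_mulV : left_inverse free_one free_inv free_mul.
Proof.
move=> a; rewrite -[a]free_of_word_repr free_invE free_mulE.
by apply/free_of_wordP; rewrite -{2}[repr a]word_invK; apply: free_eq_mulV.
Qed.

HB.instance Definition _ := isGroup.Build freeGroup
  free_mulA free_mul1 free_mulr1 free_mulV free_mulrV.

End FreeGroup.

Section Presentation.
Variable A : choiceType.

Definition gamma3 : normalSubgroup (freeGroup A) :=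
  @NormalSubgroup (freeGroup A) (gamma (freeGroup A) 3) (lcs_is_normal _ 2).

(* N_2(A), the free group with basis A in the variety of nilpotent groups of
   class at most 2. *)
Definition freeNil2 := quotientGroup gamma3.

HB.instance Definition _ := Group.on freeNil2.

Definition nil2_of_word (w : word A) : freeNil2 :=
  toquot gamma3 (free_of_word w).

Definition relators (m : nat) (r : 'I_m -> word A) : normalSubgroup freeNil2 :=
  NormalSubgroup
    (normal_closure_is_normal [set nil2_of_word (r i) | i in setT]).

(* The group < A | R > relative to the variety of nilpotent groups of class
   at most 2. *)
Definition presN2 (m : nat) (r : 'I_m -> word A) : groupType :=
  quotientGroup (relators r).

End Presentation.

Section RelationMatrix.
Local Open Scope ring_scope.

Definition exponent_sum (A : eqType) (a : A) (w : word A) : int :=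
  \sum_(x <- w | x.1 == a) (if x.2 then - 1 else 1).

Definition relation_matrix (m n : nat) (r : 'I_m -> word 'I_n) :
  'M[int]_(m, n) := \matrix_(i, j) exponent_sum j (r i).

Definition full_rank (m n : nat) (r : 'I_m -> word 'I_n) : Prop :=
  \rank (map_mx intr (relation_matrix r) : 'M[rat]_(m, n)) = minn m n.

End RelationMatrix.

(* Main.v *)
Require Import Defs.
From HB Require Import structures.
From mathcomp Require Import all_boot all_algebra.
From mathcomp Require Import boolp classical_sets.
From mathcomp Require Import ring.

(** Let [M] be the relation matrix and [v] the exponent vector of a word [w]
that represents a central element of [G].  The point is that [v] must be an
integral combination of the rows of [M] ([mem_row_lattice]).  Dividing [w] by
the corresponding product of relators, which is trivial in [G], gives a word
with zero exponents representing the same element, and such a word lies in the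
derived subgroup already in the free group ([derived_of_exponent_sum0]).  The
inclusion of [G'] in [Z(G)] is the hypothesis on the class.

Constraints on [v] come from mapping [G] to subquotients of the Heisenberg
group over the rationals.  Send the generator [a_j] to
[(phi_j, psi_j, zeta_j)], where [phi] takes integral values on the rows of [M]
and [psi] is integral and vanishes on them.  Changing [zeta] changes the third
coordinate of the [i]-th relator by [(M zeta)_i]; since [M] has rank [m] over
the rationals, a suitable [zeta] makes all these third coordinates zero.  This
is the only use of full rank: it makes the commutator parts of the relators
harmless.  The relators then land in the set of triples [(a, 0, b)] with [a]
and [b] integers, which is stable under conjugation by the image because [psi]
is integral.  The commutator of [w] with [a_j] is trivial in [G], so its image
[(0, 0, phi(v) psi_j - phi_j psi(v))] is integral
([central_pairing_int]).

It remains to choose [phi] and [psi].  The Smith normal form gives a basis of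
[Z^n] in which the row lattice of [M] is spanned by multiples [e_i] of the
first [m] basis vectors.  For each coordinate [i], let [psi] be another
coordinate [l >= m], and [phi] a rational multiple of the [i]-th coordinate;
two such [l] exist because [m <= n - 2], so one of them differs from [i].  The
constraint becomes that the [i]-th coordinate of [v] is divisible by [e_i]
(hence zero when [i >= m]), and so [v] is in the row lattice. *)

Set Implicit Arguments.
Unset Strict Implicit.
Unset Printing Implicit Defensive.

Import GRing.Theory Num.Theory.
Local Open Scope classical_set_scope.
Local Open Scope group_scope.

(** * Homomorphisms of groups *)

Section Morphisms.
Variables (G H : groupType) (f : G -> H).
Hypothesis fM : {morph f : x y / x * y}.

Lemma morph_1 : f 1 = 1.
Proof. by apply: (mulgI (f 1)); rewrite -fM !mulg1. Qed.

Lemma morph_V : {morph f : x / x^-1}.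
Proof. by move=> x; apply: (mulgI (f x)); rewrite -fM !mulgV morph_1. Qed.

Lemma morph_R : {morph f : x y / [~ x, y]}.
Proof. by move=> x y; rewrite /commg /conjg !fM !morph_V. Qed.

Lemma is_normal_preimage (K : set H) :
    is_subgroup K -> (forall x y, K x -> K (x ^ f y)) ->
  is_normal (f @^-1` K).
Proof.
move=> [K1 KF] KJ; split; last first.
  by move=> x y Kx; rewrite /preimage /= /conjg !fM morph_V; apply: KJ.
split=> [|x y Kx Ky]; rewrite /preimage /= ?morph_1 // fM morph_V.
exact: KF.
Qed.

Lemma lcs_morph i x : lcs i x -> lcs i (f x).
Proof.
elim: i x => [//|i IHi] x /= Gx.
have nH := lcs_is_normal H i.+1.
have [sP _] := is_normal_preimage nH.1 (fun u v => nH.2 u (f v)).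
apply: (Gx (f @^-1` lcs i.+1)); split=> //.
move=> _ [u Lu [v _ <-]]; rewrite /preimage /= morph_R.
by apply: sub_gen_smallest; exists (f u); [apply: IHi | exists (f v)].
Qed.

End Morphisms.

(** * Evaluation of words in a group *)

Section Evaluation.
Variables (A : choiceType) (H : groupType) (alpha : A -> H).

Definition eval_letter (x : A * bool) : H :=
  if x.2 then (alpha x.1)^-1 else alpha x.1.

Definition eval (w : word A) : H := \prod_(x <- w) eval_letter x.

Lemma eval_cons x w : eval (x :: w) = eval_letter x * eval w.
Proof. exact: big_cons. Qed.

Lemma eval_cat u v : eval (u ++ v) = eval u * eval v.
Proof. exact: big_cat. Qed.

Lemma eval_free_eq u v : free_eq u v -> eval u = eval v.
Proof.
elim=> {u v} [u [a b] v|w|v w _ ->|u v w _ -> _ ->] //.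
rewrite !eval_cat !eval_cons; congr (_ * _).
by rewrite /eval_letter; case: b => /=; rewrite ?mulKg ?mulVKg.
Qed.

Definition free_eval (x : freeGroup A) : H := eval (repr x).

Lemma free_evalE w : free_eval (free_of_word w) = eval w.
Proof. by apply/eval_free_eq/free_of_wordP/free_of_word_repr. Qed.

Lemma free_of_wordM (u v : word A) :
  free_of_word (u ++ v) = free_of_word u * free_of_word v.
Proof. by rewrite -free_mulE. Qed.

Lemma free_evalM : {morph free_eval : x y / x * y}.
Proof.
move=> x y; rewrite -[x]free_of_word_repr -[y]free_of_word_repr.
by rewrite -free_of_wordM !free_evalE eval_cat.
Qed.

Hypothesis nilH : nilpotent_class_le H 2.

Definition nil2_eval (x : freeNil2 A) : H := free_eval (repr x).

Lemma nil2_eval_toquot x : nil2_eval (toquot (gamma3 A) x) = free_eval x.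
Proof.
rewrite /nil2_eval.
have /toquotP/asboolP := toquot_repr (toquot (gamma3 A) x).
move=> /(lcs_morph free_evalM); rewrite -[lcs 2]/(gamma H 3) nilH /= => /eqP.
rewrite free_evalM (morph_V free_evalM) => /eqP e1.
by rewrite -[LHS]mulg1 -e1 mulVKg.
Qed.

Lemma nil2_evalE w : nil2_eval (nil2_of_word w) = eval w.
Proof. by rewrite nil2_eval_toquot free_evalE. Qed.

Lemma nil2_evalM : {morph nil2_eval : x y / x * y}.
Proof.
move=> x y; rewrite -[x]toquot_repr -[y]toquot_repr.
by rewrite -[_ * _]toquotM !nil2_eval_toquot free_evalM.
Qed.

(** The stability of [K] is under conjugation by the image of the evaluation
rather than by [H], because [K] will consist of integral points of a group over
the rationals, which all of [H] does not preserve. *)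
Lemma nil2_eval_ker (m : nat) (r : 'I_m -> word A) (K : set H) x :
    is_subgroup K -> (forall h y, K h -> K (h ^ nil2_eval y)) ->
    (forall i, K (eval (r i))) ->
  toquot (relators r) x = 1 -> K (nil2_eval x).
Proof.
move=> sK KJ Kr x1.
have /toquotP/asboolP : toquot (relators r) 1 = toquot (relators r) x.
  by rewrite x1.
rewrite invg1 mul1g /= => Nx; apply: (Nx (nil2_eval @^-1` K)); split.
  exact: is_normal_preimage nil2_evalM _ sK KJ.
by move=> _ [i _ <-]; rewrite /preimage /= nil2_evalE.
Qed.

End Evaluation.

(** * Exponent sums *)

Section Exponents.
Local Open Scope ring_scope.

Lemma exponent_sum_count (A : eqType) (a : A) (w : word A) :
  exponent_sum a w =
    (count_mem (a, false) w)%:Z - (count_mem (a, true) w)%:Z.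
Proof.
rewrite /exponent_sum; elim: w => [|[b s] w IHw].
  by rewrite big_nil subrr.
rewrite big_cons IHw /= !xpair_eqE; case: (b == a) => //=.
by case: s; rewrite /= ?add0n ?add1n ?PoszD //; ring.
Qed.

Lemma exponent_sum_cat (A : eqType) (a : A) (u v : word A) :
  exponent_sum a (u ++ v) = exponent_sum a u + exponent_sum a v.
Proof. exact: big_cat. Qed.

Lemma exponent_sum_inv (A : choiceType) (a : A) (w : word A) :
  exponent_sum a (word_inv w) = - exponent_sum a w.
Proof.
rewrite /exponent_sum /word_inv (perm_big _ (permEl (perm_rev _))) big_map.
rewrite -sumrN.
by apply: eq_bigr => -[b []]; rewrite ?opprK.
Qed.

(** Every homomorphism from the free group to an abelian group factors through
the exponent sums. *)
Lemma signed_sumE n (V : zmodType) (g : 'I_n -> V) (w : word 'I_n) :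
  \sum_(x <- w) (if x.2 then - g x.1 else g x.1) =
  \sum_j g j *~ exponent_sum j w.
Proof.
elim: w => [|[a s] w IHw].
  by rewrite big_nil big1 // => j _; rewrite /exponent_sum big_nil.
rewrite big_cons IHw.
under [RHS]eq_bigr => j _ do rewrite -cat1s exponent_sum_cat mulrzDr.
rewrite big_split; congr (_ + _) => /=.
rewrite (bigD1 a) //= big1 => [|j /negPf ne]; last first.
  by rewrite /exponent_sum big_cons big_nil /= eq_sym ne.
by rewrite /exponent_sum big_cons big_nil eqxx /=; case: s; rewrite !addr0.
Qed.

End Exponents.

(** The first letter [x] of such a word must be compensated by a later inverse
letter, and [x u x^-1 v] equals [u v] up to a commutator; the shorter word
[u v] still has zero exponents. *)
Lemma derived_of_exponent_sum0 (A : choiceType) (w : word A) :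
  (forall a, exponent_sum a w = 0%R) -> derived (freeGroup A) (free_of_word w).
Proof.
have sD : is_subgroup (derived (freeGroup A)) by apply: generated_is_subgroup.
have [k] := ubnP (size w); elim: k w => // k IHk [|x w]; first by case: sD.
rewrite ltnS => /= le_k w0.
have : letter_inv x \in w.
  have /eqP := w0 x.1; rewrite exponent_sum_count subr_eq0 eqz_nat.
  case: x {w0} => a s; rewrite /= !xpair_eqE eqxx -!has_pred1 !has_count.
  by case: s; rewrite /= !add0n add1n => /eqP; [move=> ->|move=> <-].
move=> /splitPr def_w; case: def_w le_k w0 => u v.
rewrite size_cat /= addnS => le_k w0.
have {}w0 a : exponent_sum a (u ++ v) = 0%R.
  rewrite -[RHS](w0 a) -cat1s exponent_sum_cat -[_ :: v]cat1s !exponent_sum_cat.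
  rewrite -[[:: letter_inv x]]/(word_inv [:: x]) exponent_sum_inv.
  by ring.
have Duv : derived _ (free_of_word (u ++ v)).
  by apply: IHk => //; rewrite size_cat (leq_ltn_trans _ le_k).
have -> : free_of_word (x :: u ++ letter_inv x :: v) =
    [~ (free_of_word [:: x])^-1, (free_of_word u)^-1] * free_of_word (u ++ v).
  rewrite -cat1s -[_ :: v]cat1s !free_of_wordM.
  rewrite -[[:: letter_inv x]]/(word_inv [:: x]) -free_invE.
  by rewrite /commg /conjg !invgK !mulgA mulgVK.
apply: (subgroupM sD) Duv; apply: sub_gen_smallest.
by exists (free_of_word [:: x])^-1 => //; exists (free_of_word u)^-1.
Qed.

(** * Membership in the row lattice of an integer matrix *)

Section RowLattice.
Local Open Scope ring_scope.

Lemma mulmx_col (R : pzRingType) (m n p : nat) (A : 'M[R]_(m, n))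
    (B : 'M[R]_(n, p)) j :
  A *m col j B = col j (A *m B).
Proof. by rewrite !colE mulmxA. Qed.

(** If [v] is not in the row lattice of [M], then its class in the abelian group
presented by [M] has a nonzero exterior product with some other class.  The
alternating forms [phi /\ psi] with values modulo 1 suffice to detect this,
and the hypothesis says that all of them vanish on [v]. *)
Lemma mem_row_lattice (m n : nat) (M : 'M[int]_(m, n)) (v : 'rV[int]_n) :
    (m + 2 <= n)%N ->
    (forall (phi : 'cV[rat]_n) (psi : 'cV[int]_n),
       (forall i, (map_mx intr M *m phi) i 0 \is a Num.int) ->
       M *m psi = 0 ->
       forall j, (map_mx intr v *m phi) 0 0 * (psi j 0)%:~R
                 - phi j 0 * ((v *m psi) 0 0)%:~R \is a Num.int) ->
  exists c : 'rV[int]_m, v = c *m M.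
Proof.
move=> le_m_n Hv.
have [L Lu [Q Qu [d _ MLDQ]]] := int_Smith_normal_form M.
set D := \matrix_(i, j) _ in MLDQ.
(* In the basis formed by the rows of [Q], the vector [v] has coordinates [t]
   and the row lattice is spanned by the [e i] times the basis vectors. *)
pose t := v *m invmx Q.
pose e (i : 'I_n) : int := if (i < m)%N then d`_i else 0.
have LDcol k i : exists a, (L *m D) k i = a * e i.
  rewrite /e; case: ltnP => [lt_im | le_mi].
    exists (L k (Ordinal lt_im)).
    rewrite mxE (bigD1 (Ordinal lt_im)) //= big1 => [|h ne_h].
      by rewrite mxE eqxx mulr1n addr0.
    rewrite mxE (_ : _ == _ = false) ?mulr0n ?mulr0 //.
    by apply: contraNF ne_h => /eqP eq_hi; apply/eqP/val_inj.
  exists 0; rewrite mxE big1 ?mulr0 // => h _.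
  by rewrite mxE ltn_eqF ?mulr0n ?mulr0 // (leq_trans (ltn_ord h)).
have et i : (e i %| (t 0 i)%R)%Z.
  have [l ne_li le_ml] : exists2 l : 'I_n, l != i & (m <= l)%N.
    have lt1 : (m.+1 < n)%N by rewrite -addn2.
    have [eq_i|ne_i] := eqVneq i (Ordinal lt1); last first.
      by exists (Ordinal lt1); rewrite ?leqnSn // eq_sym.
    exists (Ordinal (ltnW lt1)) => //.
    by rewrite eq_i -val_eqE /= neq_ltn ltnSn.
  pose psi := col l (invmx Q).
  have MQi : M *m invmx Q = L *m D by rewrite MLDQ mulmxK.
  have Mpsi : M *m psi = 0.
    rewrite mulmx_col MQi; apply/colP => k; rewrite !mxE big1 // => h _.
    by rewrite mxE ltn_eqF ?mulr0n ?mulr0 // (leq_trans (ltn_ord h)).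
  (* Combining the constraints with the coefficients of the [l]-th basis vector,
     on which [psi] is 1 and [phi] is 0. *)
  have Hc (c : rat) : c * (e i)%:~R \is a Num.int ->
      c * (t 0 i)%:~R \is a Num.int.
    move=> ce_int.
    pose phi : 'cV[rat]_n := c *: map_mx intr (col i (invmx Q)).
    have phiE p (N : 'M[int]_(p, n)) k :
        (map_mx intr N *m phi) k 0 = c * ((N *m invmx Q) k i)%:~R.
      rewrite -scalemxAr -map_mxM mulmx_col [LHS]mxE; congr (_ * _).
      by rewrite [LHS]mxE; congr _%:~R; rewrite [LHS]mxE.
    have Mphi k : (map_mx intr M *m phi) k 0 \is a Num.int.
      have [a LDki] := LDcol k i.
      by rewrite phiE MQi LDki intrM mulrCA rpredM ?intr_int.
    have psiE : (row l Q *m psi) 0 0 = 1.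
      by rewrite mulmx_col -row_mul mulmxV // !mxE eqxx.
    have phi0 : (map_mx intr (row l Q) *m phi) 0 0 = 0.
      by rewrite phiE -row_mul mulmxV // !mxE (negPf ne_li) mulr0.
    have -> : c * (t 0 i)%:~R = \sum_j (Q l j)%:~R *
        ((map_mx intr v *m phi) 0 0 * (psi j 0)%:~R
         - phi j 0 * ((v *m psi) 0 0)%:~R).
      under eq_bigr => j _ do rewrite mulrBr mulrCA (mulrA _ (phi j 0)).
      rewrite sumrB -mulr_sumr -mulr_suml.
      have -> : \sum_j (Q l j)%:~R * phi j 0 = 0.
        by rewrite -[RHS]phi0 mxE; apply: eq_bigr => j _; rewrite !mxE.
      have -> : \sum_j (Q l j)%:~R * (psi j 0)%:~R = 1 :> rat.
        rewrite -[RHS]/(1%:~R) -psiE mxE rmorph_sum.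
        by apply: eq_bigr => j _; rewrite [row l Q _ _]mxE rmorphM.
      by rewrite mul0r subr0 mulr1 phiE.
    by apply: rpred_sum => j _; rewrite rpredM ?intr_int ?Hv.
  have [e0|ne0] := eqVneq (e i) 0.
    have [->|t0] := eqVneq (t 0 i) 0; first by rewrite dvdz0.
    (* As [e i] is 0, every rational [c] is allowed; this one would make 1/2
       an integer. *)
    have /(_ _)/intrP[|a] := Hc ((t 0 i)%:~R * 2)^-1; first by rewrite e0 mulr0.
    have t0' : (t 0 i)%:~R != 0 :> rat by rewrite intr_eq0.
    rewrite invfM mulrC mulrA divff // mul1r => ha.
    have : 1%:~R = (2 * a)%:~R :> rat by rewrite intrM -ha mulfV.
    move=> /intr_inj /(congr1 (fun z => 2 %| z)%Z).
    by rewrite dvdz_mulr.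
  have e0' : (e i)%:~R != 0 :> rat by rewrite intr_eq0.
  have /(_ _)/intrP[|a] := Hc ((e i)%:~R)^-1; first by rewrite mulVf.
  move=> /(canRL (mulVKf e0')); rewrite -intrM => /intr_inj ->.
  by rewrite dvdz_mulr.
have le_mn : (m <= n)%N by apply: leq_trans le_m_n; rewrite leq_addr.
pose s : 'rV[int]_m :=
  \row_k ((t 0 (widen_ord le_mn k))%R %/ e (widen_ord le_mn k))%Z.
have tE : t = s *m D.
  apply/rowP => i; rewrite [RHS]mxE; have := et i; rewrite {1}/e.
  case: ltnP => [lt_im _ | le_mi].
    rewrite (bigD1 (Ordinal lt_im)) //= big1 => [|h ne_h].
      rewrite [s _ _]mxE [D _ _]mxE eqxx mulr1n addr0.
      have -> : widen_ord le_mn (Ordinal lt_im) = i by apply: val_inj.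
      have -> : d`_(Ordinal lt_im) = e i by rewrite /e lt_im.
      by rewrite divzK.
    rewrite [D _ _]mxE (_ : _ == _ = false) ?mulr0n ?mulr0 //.
    by apply: contraNF ne_h => /eqP eq_hi; apply/eqP/val_inj.
  rewrite dvd0z => /eqP ->; rewrite big1 // => h _.
  by rewrite [D _ _]mxE ltn_eqF ?mulr0n ?mulr0 // (leq_trans (ltn_ord h)).
exists (s *m invmx L).
by rewrite MLDQ -!mulmxA mulKmx // mulmxA -tE /t mulmxKV.
Qed.

End RowLattice.

(** * The Heisenberg group *)

Section Heisenberg.
Variable R : comNzRingType.

(** The triple [(x, y, z)] stands for the upper unitriangular 3 x 3 matrix with
entries [x] and [y] above the diagonal and [z] in the corner. *)
Definition heisenberg : Type := (R * R * R)%type.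

HB.instance Definition _ := Choice.on heisenberg.

Definition heis_one : heisenberg := (0, 0, 0)%R.
Definition heis_mul (p q : heisenberg) : heisenberg :=
  (p.1.1 + q.1.1, p.1.2 + q.1.2, p.2 + q.2 + p.1.1 * q.1.2)%R.
Definition heis_inv (p : heisenberg) : heisenberg :=
  (- p.1.1, - p.1.2, - p.2 + p.1.1 * p.1.2)%R.

Lemma heis_eq (p q : heisenberg) :
  p.1.1 = q.1.1 -> p.1.2 = q.1.2 -> p.2 = q.2 -> p = q.
Proof. by case: p q => [[x y] z] [[x' y'] z'] /= -> -> ->. Qed.

Lemma heis_mulA : associative heis_mul.
Proof. by move=> p q s; apply: heis_eq => /=; ring. Qed.

Lemma heis_mul1 : left_id heis_one heis_mul.
Proof. by move=> p; apply: heis_eq => /=; ring. Qed.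

Lemma heis_mulr1 : right_id heis_one heis_mul.
Proof. by move=> p; apply: heis_eq => /=; ring. Qed.

Lemma heis_mulV : left_inverse heis_one heis_inv heis_mul.
Proof. by move=> p; apply: heis_eq => /=; ring. Qed.

Lemma heis_mulrV : right_inverse heis_one heis_inv heis_mul.
Proof. by move=> p; apply: heis_eq => /=; ring. Qed.

HB.instance Definition _ := isGroup.Build heisenberg
  heis_mulA heis_mul1 heis_mulr1 heis_mulV heis_mulrV.

Lemma heis_mulE (p q : heisenberg) : p * q = heis_mul p q.
Proof. by []. Qed.

Lemma heis_invE (p : heisenberg) : p^-1 = heis_inv p.
Proof. by []. Qed.

Lemma heis_commg (p q : heisenberg) :
  [~ p, q] = (0, 0, p.1.1 * q.1.2 - q.1.1 * p.1.2)%R.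
Proof.
rewrite /commg /conjg !heis_mulE !heis_invE.
by apply: heis_eq => /=; ring.
Qed.

Lemma heis_conjg (p q : heisenberg) :
  p ^ q = (p.1.1, p.1.2, p.2 + p.1.1 * q.1.2 - q.1.1 * p.1.2)%R.
Proof.
rewrite /conjg !heis_mulE !heis_invE.
by apply: heis_eq => /=; ring.
Qed.

Lemma heis_nil2 : nilpotent_class_le heisenberg 2.
Proof.
have center_sub (p : heisenberg) : lcs 1 p -> p.1 = (0, 0)%R.
  move=> p1; apply: (p1 [set q : heisenberg | q.1 = (0, 0)%R]); split.
    split=> [//|x y hx hy].
    by rewrite /mkset /= hx hy /= oppr0 addr0.
  by move=> _ [x _ [y _ <-]]; rewrite /mkset heis_commg.
rewrite /nilpotent_class_le /gamma /=; apply/seteqP; split; last first.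
  by move=> _ ->; case: (generated_is_subgroup
    [set [~ x, y] | x in lcs (G:=heisenberg) 1 & y in setT]).
move=> p p1; apply: (p1 [set 1]); split.
  by split=> // x y /= -> ->; rewrite mulgV.
move=> _ [x /center_sub hx [y _ <-]].
by rewrite /mkset heis_commg hx /= mul0r mulr0 subrr.
Qed.

(** The third coordinates of the generators act additively, through the exponent
sums only. *)
Lemma eval_heis n (x y z : 'I_n -> R) (w : word 'I_n) :
  eval (fun j => (x j, y j, z j) : heisenberg) w =
  (\sum_j x j *~ exponent_sum j w, \sum_j y j *~ exponent_sum j w,
   (eval (fun j => (x j, y j, 0%R) : heisenberg) w).2
    + \sum_j z j *~ exponent_sum j w)%R.
Proof.
rewrite -!signed_sumE; elim: w => [|[a s] w IHw].
  by rewrite /eval !big_nil /= addr0.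
rewrite [LHS]eval_cons [in RHS]eval_cons IHw !big_cons !heis_mulE.
rewrite /heis_mul /=.
have -> : (eval (fun j => (x j, y j, 0%R) : heisenberg) w).1.2 =
    (\sum_(x <- w) (if x.2 then - y x.1 else y x.1))%R.
  elim: w {IHw} => [|[b s'] w IHw]; first by rewrite /eval !big_nil.
  by rewrite eval_cons big_cons heis_mulE /= IHw; case: s'.
by apply: heis_eq; case: s => /=; rewrite ?heis_invE /=; ring.
Qed.

End Heisenberg.

(** * Central words *)

Definition exponents n (w : word 'I_n) : 'rV[int]_n :=
  (\row_j exponent_sum j w)%R.

Lemma exponents_mul n (w : word 'I_n) (g : 'cV[rat]_n) :
  (\sum_j g j 0 *~ exponent_sum j w = (map_mx intr (exponents w) *m g) 0 0)%R.
Proof.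
by rewrite mxE; apply: eq_bigr => j _; rewrite !mxE mulrzl.
Qed.

Lemma row_relation_matrix m n (r : 'I_m -> word 'I_n) i :
  row i (relation_matrix r) = exponents (r i).
Proof. by apply/rowP => j; rewrite !mxE. Qed.

(** The commutator of [w] with the generator [j], computed in a Heisenberg group
where the relators have been given integral images. *)
Lemma central_pairing_int m n (r : 'I_m -> word 'I_n) (w : word 'I_n)
    (phi : 'cV[rat]_n) (psi : 'cV[int]_n) :
    row_free (map_mx intr (relation_matrix r) : 'M[rat]_(m, n)) ->
    (forall u, commute (toquot (relators r) (nil2_of_word w))
                       (toquot (relators r) (nil2_of_word u))) ->
    (forall i, (map_mx intr (relation_matrix r) *m phi) i 0 \is a Num.int)%R ->
    (relation_matrix r *m psi = 0)%R ->
  forall j, ((map_mx intr (exponents w) *m phi) 0 0 * (psi j 0)%:~R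
    - phi j 0 * ((exponents w *m psi) 0 0)%:~R \is a Num.int)%R.
Proof.
move=> freeM cw Mphi Mpsi j.
set M : 'M[rat]_(m, n) := map_mx intr (relation_matrix r) in freeM Mphi.
pose psiQ : 'cV[rat]_n := map_mx intr psi.
pose coords z a : heisenberg rat := (phi a 0, psiQ a 0, z a)%R.
pose c : 'cV[rat]_m := (\col_i (eval (coords (fun=> 0)) (r i)).2)%R.
(* The third coordinate of each relator becomes 0. *)
pose zeta : 'cV[rat]_n := (pinvmx M *m (- c))%R.
pose alpha := coords (fun a => zeta a 0%R).
have alphaE u : eval alpha u =
    ((map_mx intr (exponents u) *m phi) 0 0,
     ((exponents u *m psi) 0 0)%:~R,
     (eval (coords (fun=> 0)) u).2
       + (map_mx intr (exponents u) *m zeta) 0 0)%R.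
  rewrite [LHS]eval_heis !exponents_mul /psiQ -map_mxM; congr (_, _, _).
  by rewrite [LHS]mxE.
pose K := [set p : heisenberg rat |
  [/\ p.1.1 \is a Num.int, p.1.2 = 0%R & p.2 \is a Num.int]].
have sK : is_subgroup K.
  split=> [|p q [p1 p2 p3] [q1 q2 q3]].
    by split; rewrite ?rpred0.
  rewrite /K /mkset heis_mulE heis_invE /=; split.
  - by rewrite rpredB.
  - by rewrite p2 q2 subr0.
  - by rewrite q2 mulr0 oppr0 mulr0 !addr0 rpredB.
have evalE y : (nil2_eval alpha y).1.2 \is a Num.int.
  rewrite -[y]toquot_repr -[repr y]free_of_word_repr -/(nil2_of_word _).
  by rewrite (nil2_evalE _ (heis_nil2 _)) alphaE /= intr_int.
have KJ h y : K h -> K (h ^ nil2_eval alpha y).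
  move=> [h1 h2 h3]; rewrite /K /mkset heis_conjg; split=> //=.
  by rewrite h2 mulr0 subr0 rpredD // rpredM // evalE.
have Kr i : K (eval alpha (r i)).
  rewrite alphaE -row_relation_matrix !map_row -/M -!row_mul.
  split=> /=.
  - by rewrite mxE.
  - by rewrite Mpsi row0 mxE.
  - by rewrite /zeta mulmxA mulmxVp // mul1mx !mxE subrr rpred0.
pose u : word 'I_n := [:: (j, false)].
have := @nil2_eval_ker _ _ alpha (heis_nil2 _) _ r K
  [~ nil2_of_word w, nil2_of_word u] sK KJ Kr.
rewrite (morph_R (@toquotM _ _)) => /(_ _)[|_ _].
  exact/eqP/commgP.
rewrite (morph_R (nil2_evalM _ (heis_nil2 _))) !(nil2_evalE _ (heis_nil2 _)).
rewrite heis_commg /= !alphaE /=.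
have expu (g : 'cV[rat]_n) : ((map_mx intr (exponents u) *m g) 0 0 = g j 0)%R.
  by rewrite -exponents_mul -signed_sumE big_seq1.
have -> : (((exponents u *m psi) 0 0)%:~R = (psi j 0)%:~R :> rat)%R.
  have <- : (psiQ j 0 = (psi j 0)%:~R)%R by rewrite mxE.
  by rewrite -expu /psiQ -map_mxM [RHS]mxE.
by rewrite expu.
Qed.

(** The exponent vectors of the words that are trivial in the presented group
form a subgroup of [Z^n], which contains the rows of the relation matrix. *)
Lemma trivial_word_exponents m n (r : 'I_m -> word 'I_n) (c : 'rV[int]_m) :
  exists2 u : word 'I_n, toquot (relators r) (nil2_of_word u) = 1 &
    exponents u = (c *m relation_matrix r)%R.
Proof.
pose P (v : 'rV[int]_n) := exists2 u : word 'I_n,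
  toquot (relators r) (nil2_of_word u) = 1 & exponents u = v.
have P0 : P 0%R.
  exists [::]; first exact: (morph_1 (@toquotM _ _)).
  by apply/rowP => j; rewrite !mxE /exponent_sum big_nil.
have PD v v' : P v -> P v' -> P (v + v')%R.
  move=> [u u1 <-] [u' u'1 <-]; exists (u ++ u').
    by rewrite /nil2_of_word free_of_wordM !toquotM u1 u'1 mulg1.
  by apply/rowP => j; rewrite !mxE exponent_sum_cat.
have PN v : P v -> P (- v)%R.
  move=> [u u1 <-]; exists (word_inv u).
    rewrite /nil2_of_word -free_invE (morph_V (@toquotM _ _)).
    by rewrite (morph_V (@toquotM _ _)) [toquot _ (toquot _ _)]u1 invg1.
  by apply/rowP => j; rewrite !mxE exponent_sum_inv.
have PZ (a : int) v : P v -> P (a *: v)%R.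
  move=> Pv; have Pn k : P ((k%:Z : int) *: v)%R.
    elim: k => [|k IHk]; first by rewrite scale0r.
    by rewrite -[k.+1]addn1 PoszD scalerDl scale1r; apply: PD.
  by case: a => k; rewrite ?NegzE ?scaleNr; [|apply: PN]; apply: Pn.
rewrite -/(P _) mulmx_sum_row; elim/big_ind: _ => // i _; apply: PZ.
rewrite row_relation_matrix; exists (r i) => //.
have : normal_set (relators r) (nil2_of_word (r i)).
  by move=> B [_]; apply; exists i.
by move=> Nr; apply/esym/toquotP/asboolP; rewrite invg1 mul1g.
Qed.

Theorem theorem4p8 (n m : nat) (r : 'I_m -> word 'I_n) (G : groupType)
    (finG : finitely_generated G)
    (nilG : nilpotent_class_le G 2)
    (presG : isomorphic G (presN2 r))
    (rankr : full_rank r)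
    (le_m_n : (m + 2 <= n)%N) :
  center G = derived G.
Proof.
apply/seteqP; split=> [z cz | z Dz x]; last first.
  apply/commgP.
  have : gamma G 3 [~ z, x].
    by apply: sub_gen_smallest; exists z => //; exists x.
  by rewrite nilG => /= /eqP.
have [f [g fK gK]] := presG.
have gM : {morph g : x y / x * y} := can2_gmulfM fK gK.
pose pi (w : word 'I_n) : presN2 r := toquot (relators r) (nil2_of_word w).
have piE (x : presN2 r) : exists w, x = pi w.
  exists (repr (repr (repr x))).
  by rewrite /pi /nil2_of_word free_of_word_repr !toquot_repr.
have [w fz] := piE (f z).
have cw u : commute (pi w) (pi u).
  rewrite -fz -[pi u]gK; exact/gmulf_commute/cz.
have freeM : row_free (map_mx intr (relation_matrix r) : 'M[rat]_(m, n)).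
  rewrite /row_free rankr; apply/eqP/minn_idPl.
  by apply: leq_trans le_m_n; rewrite leq_addr.
have [phi psi|c vc] :=
  @mem_row_lattice _ _ (relation_matrix r) (exponents w) le_m_n.
  exact: central_pairing_int.
(* [w ++ u] has zero exponents and represents the same element as [w]. *)
have [u u1 expu] := trivial_word_exponents r (- c)%R.
have -> : z = g (pi (w ++ u)).
  rewrite /pi /nil2_of_word free_of_wordM !toquotM [X in _ * X]u1 mulg1.
  by rewrite -[toquot _ _]fz fK.
have gpiM : {morph (fun x : freeGroup 'I_n =>
    g (toquot (relators r) (toquot (gamma3 _) x))) : x y / x * y}.
  by move=> x y; rewrite !toquotM gM.
apply: (lcs_morph gpiM (i:=1)); apply: derived_of_exponent_sum0 => j.
have := congr1 (fun v : 'rV_n => v 0%R j) expu.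
rewrite mulNmx -vc !mxE exponent_sum_cat => ->.
exact: subrr.
Qed.
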